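(* Let $d$ be a power of $2$ and $d'=d+\log_2 d$. For $x\in\{0,1\}^{d'}$ let $\mathsf{val}(x)=\sum_{j=1}^{d'}x_j2^{j-1}$, and write $x\prec y$ if $\mathsf{val}(x)<\mathsf{val}(y)$. For $i\in[d]$ let $C_i=\{x:\mathsf{val}(x_{d'}\cdots x_{d+1})=i-1\}$ (value of the top $\log_2 d$ bits read as a binary number). Sample: $k$ uniformly from $\{1,\dots,\tfrac12\log_2 d\}$; $R\subseteq[d]$ uniformly among sets of size $2^k$; independently for each $i\in[d]$, $r_i$ uniform in $R$; independently for each $b\in[d]$, $\alpha_b$ uniform in $\{\pm1\}$; independently for each $i\in[d]$, $\beta_i$ uniform in $\{\pm1\}$. Let $f(x)=\sum_{b\in[d']\setminus R}x_b3^b+\alpha_{r_i}x_{r_i}3^{r_i}$ and $g(x)=\sum_{b\in[d']\setminus R}x_b3^b+\beta_i x_{r_i}3^{r_i}$, where $i$ is such that $x\in C_i$. For a function $h$ and $x\prec y$ let $\mathsf{sgn}_h(x,y)$ be $1$, $0$, $-1$ according as $h(x)<h(y)$, $h(x)=h(y)$, $h(x)>h(y)$. For a set $Q\subseteq\{0,1\}^{d'}$, let $G^Q_h$ be the signed graph on $Q$ in which each pair $x\prec y$ of $Q$ is joined by an edge labeled $\mathsf{sgn}_h(x,y)$; let $\boldsymbol{G}^Q_Y$ and $\boldsymbol{G}^Q_N$ be the distributions of $G^Q_f$ and $G^Q_g$ respectively. Then there is an absolute constant $C$ such that for all sufficiently small $\delta>0$ and sufficiently large $d$, every $Q$ with $|Q|\le\delta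 d\log d$ satisfies $\|\boldsymbol{G}^Q_Y-\boldsymbol{G}^Q_N\|_{\mathrm{TV}}\le C\delta$.
   Context: $\|\cdot\|_{\mathrm{TV}}$ denotes total variation distance between distributions. *)

(* Defs.v *)
From HB Require Import structures.
From mathcomp Require Import all_boot all_order all_algebra.
From mathcomp Require Import reals.

Set Implicit Arguments.
Unset Strict Implicit.
Unset Printing Implicit Defensive.

Import Order.TTheory GRing.Theory Num.Theory.
Local Open Scope ring_scope.

Definition bits_val (n : nat) (s : 'I_n -> bool) : nat :=
  (\sum_(j < n) s j * 2 ^ j)%N.

Lemma bits_val_lt (n : nat) (s : 'I_n -> bool) : (bits_val s < 2 ^ n)%N.
Proof.
rewrite /bits_val; elim: n s => [|n IHn] s; first by rewrite big_ord0.
rewrite big_ord_recr /= expnS mul2n -addnn -addSn.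
by rewrite leq_add ?IHn //; case: (s _); rewrite ?mul1n ?mul0n.
Qed.

(* d, for m = log_2 d. *)
Definition hdim (m : nat) : nat := (2 ^ m)%N.

(* {0,1}^d'. Coordinates and cells are numbered from 0: the ordinal b stands
   for the coordinate b.+1 of {1, ..., d'}, so that its weight is 2 ^ b in val
   and 3 ^ b.+1 in f and g. Through lshift, [d] is the set of the d low
   coordinates; rshift (hdim m) j is the j-th of the m top ones. *)
Notation cube m := {ffun 'I_(hdim m + m) -> bool}.

Definition val_cube (m : nat) (x : cube m) : nat := bits_val x.

Definition prec (m : nat) (x y : cube m) : bool := (val_cube x < val_cube y)%N.

Definition top_bits (m : nat) (x : cube m) : 'I_m -> bool :=
  fun j => x (rshift (hdim m) j).

Definition C_ (m : nat) (i : 'I_(hdim m)) : {set cube m} :=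
  [set x | bits_val (top_bits x) == i].

Definition cell (m : nat) (x : cube m) : 'I_(hdim m) :=
  Ordinal (bits_val_lt (top_bits x)).

Lemma mem_C (m : nat) (i : 'I_(hdim m)) (x : cube m) :
  (x \in C_ i) = (cell x == i).
Proof. by rewrite inE. Qed.

(* A boolean s encodes the sign (-1) ^+ s. *)
Section Functions.
Variables (m : nat) (R : {set 'I_(hdim m)}) (r : {ffun 'I_(hdim m) -> 'I_(hdim m)}).

Definition base_sum (x : cube m) : int :=
  \sum_(b | b \notin [set lshift m a | a in R]) (x b)%:R * 3%:Z ^+ b.+1.

Definition f_fun (alpha : {ffun 'I_(hdim m) -> bool}) (x : cube m) : int :=
  let i := cell x in
  base_sum x + (-1) ^+ alpha (r i) * (x (lshift m (r i)))%:R * 3%:Z ^+ (r i).+1.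

Definition g_fun (beta : {ffun 'I_(hdim m) -> bool}) (x : cube m) : int :=
  let i := cell x in
  base_sum x + (-1) ^+ beta i * (x (lshift m (r i)))%:R * 3%:Z ^+ (r i).+1.

End Functions.

(* 'Z_3 only serves as a finite type with three distinct elements 1, 0, -1. *)
Definition sgn (m : nat) (h : cube m -> int) (x y : cube m) : 'Z_3 :=
  if h x < h y then 1 else if h x == h y then 0 else -1.

(* A signed graph on Q with edges oriented by prec; None means no edge. *)
Notation sgraph m := {ffun cube m * cube m -> option 'Z_3}.

Definition graph_of (m : nat) (Q : {set cube m}) (h : cube m -> int) : sgraph m :=
  [ffun p : cube m * cube m =>
     if [&& p.1 \in Q, p.2 \in Q & prec p.1 p.2] then Some (sgn h p.1 p.2)
     else None].

Section Laws.
Variable K : realType.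

Definition unif (T : finType) (A : {set T}) (a : T) : K :=
  (a \in A)%:R / #|A|%:R.

(* Expectation over (R, r, alpha, beta). When log_2 d is odd, k ranges over
   the integers between 1 and (log_2 d) / 2. *)
Definition expect (m : nat)
    (F : {set 'I_(hdim m)} -> {ffun 'I_(hdim m) -> 'I_(hdim m)} ->
         {ffun 'I_(hdim m) -> bool} -> {ffun 'I_(hdim m) -> bool} -> K) : K :=
  \sum_(k : 'I_(m./2).+1) unif [set k : 'I_(m./2).+1 | (1 <= k)%N] k *
  \sum_(R : {set 'I_(hdim m)})
     unif [set R : {set 'I_(hdim m)} | #|R| == (2 ^ k)%N] R *
  \sum_(r : {ffun 'I_(hdim m) -> 'I_(hdim m)}) (\prod_i unif R (r i)) *
  \sum_(alpha : {ffun 'I_(hdim m) -> bool}) (\prod_b unif [set: bool] (alpha b)) *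
  \sum_(beta : {ffun 'I_(hdim m) -> bool}) (\prod_i unif [set: bool] (beta i)) *
  F R r alpha beta.

Definition law_Y (m : nat) (Q : {set cube m}) (G : sgraph m) : K :=
  expect (fun R r alpha _ => (graph_of Q (f_fun R r alpha) == G)%:R).

Definition law_N (m : nat) (Q : {set cube m}) (G : sgraph m) : K :=
  expect (fun R r _ beta => (graph_of Q (g_fun R r beta) == G)%:R).

Definition dTV (T : finType) (p q : T -> K) : K :=
  2^-1 * \sum_(t : T) `|p t - q t|.

End Laws.

(* Main.v *)
(* Two points of Q in different cells are always ordered by their top bits, so
   the graph only depends on its restriction to each cell, and the restriction to
   cell i depends on the sign of bit r_i only if two points of Q in this cell
   differ at r_i and agree on all higher low bits outside R ("r_i separates").
   If the separating r_i are pairwise distinct, both models use independent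
   uniform signs there; hence the distance is at most the probability that two
   cells collide at the same separating bit. With n_b(R) the number of cells
   separated by b, this is at most sum_(b in R) min(1, (n_b(R) / 2^k)^2).
   Let R be the image of {0, ..., 2^k - 1} under a random permutation s. By
   symmetry the sum becomes 2^k min(1, (n / 2^k)^2) with n = n_(s 0)(R), and n
   only increases when k is replaced by its largest value. Summing over k then
   gives at most 4 n, and E n <= |Q| / (d - sqrt d) because, after exchanging s 0
   with a point outside R, one counts the branching levels of the tries formed by
   the points of Q in each cell. *)
Require Import Defs.
From HB Require Import structures.
From mathcomp Require Import all_boot all_order all_fingroup all_algebra.
From mathcomp Require Import reals.
From mathcomp Require Import ring lra zify.

Set Implicit Arguments.
Unset Strict Implicit.
Unset Printing Implicit Defensive.

Import Order.TTheory GRing.Theory Num.Theory.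
Local Open Scope ring_scope.


(** * Expansions in base [B] with signed digits *)

Lemma base_expansion_le (B k : nat) (u : 'I_k -> int) :
  (forall b, `|u b| <= B%:Z - 1) ->
  `|\sum_b u b * B%:Z ^+ b| <= B%:Z ^+ k - 1.
Proof.
elim: k u => [|k IHk] u uB; first by rewrite big_ord0 normr0.
rewrite big_ord_recr /=; apply: le_trans (ler_normD _ _) _.
have := IHk (fun b => u (widen_ord (leqnSn k) b)) (fun b => uB _).
have : `|u ord_max * B%:Z ^+ k| <= (B%:Z - 1) * B%:Z ^+ k.
  by rewrite normrM [`|_ ^+ k|]ger0_norm ?exprn_ge0// ler_wpM2r ?exprn_ge0// uB.
rewrite exprS; set s := `|_|; set s' := `|_|; set B' := _ ^+ k; lia.
Qed.

(** The leading digit contributes at least [B ^ t], and the lower ones at most [B ^ t - 1] in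
    absolute value. The digit bound [B - 1] accommodates differences of bits for [B = 2], and
    differences of digits in {-1, 0, 1} for [B = 3]. *)
Lemma base_expansion_gt0 (n B : nat) (e : 'I_n -> int) (t : 'I_n) :
  (0 < B)%N -> (forall b, `|e b| <= B%:Z - 1) ->
  (forall b : 'I_n, (t < b)%N -> e b = 0) -> 0 < e t ->
  0 < \sum_b e b * B%:Z ^+ b.
Proof.
move=> B0; elim: n e t => [|n IHn] e t eB et0 et; first by case: t {et et0}.
rewrite big_ord_recr /=.
have tE : t = ord_max \/ exists t', t = widen_ord (leqnSn n) t'.
  have [tn|nt] := ltnP t n; last first.
    by left; apply/val_inj/eqP; rewrite eqn_leq nt -ltnS ltn_ord.
  by right; exists (Ordinal tn); apply/val_inj.
case: tE => [tE|[t' tE]]; last first.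
  rewrite (et0 ord_max) ?mul0r ?addr0; last by rewrite tE /=.
  apply: (IHn (fun b => e (widen_ord (leqnSn n) b)) t') => [b|b tb|].
  - exact: eB.
  - by apply: et0; rewrite tE.
  - by rewrite -tE.
have := base_expansion_le (fun b => eB (widen_ord (leqnSn n) b)).
rewrite ler_norml => /andP[h _].
have : B%:Z ^+ n <= e ord_max * B%:Z ^+ n.
  by rewrite ler_peMl ?exprn_ge0// -tE -gtz0_ge1.
move: h; set s := \sum_(_ < _) _; set B' := _ ^+ n; lia.
Qed.

(** * Bits that separate points of a cell *)

Section Geometry.
Variable m : nat.
Implicit Types (Q S : {set cube m}) (R : {set 'I_(hdim m)}) (x y : cube m).

Definition separates S R (b : 'I_(hdim m)) : bool :=
  [exists x in S, exists y in S, (x (lshift m b) != y (lshift m b)) &&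
    [forall c : 'I_(hdim m),
       (b < c)%N && (c \notin R) ==> (x (lshift m c) == y (lshift m c))]].

Lemma separatesP S R b :
  reflect (exists x y, [/\ x \in S, y \in S, x (lshift m b) != y (lshift m b) &
     forall c : 'I_(hdim m), (b < c)%N -> c \notin R ->
       x (lshift m c) = y (lshift m c)])
    (separates S R b).
Proof.
apply: (iffP existsP) => [[x /andP[xS /existsP[y /and3P[yS xy /forallP H]]]]|].
  exists x, y; split=> // c bc cR; apply/eqP.
  by have := H c; rewrite bc cR.
move=> [x [y [xS yS xy H]]]; exists x; rewrite xS; apply/existsP; exists y.
rewrite yS xy; apply/forallP => c; apply/implyP => /andP[bc cR].
by apply/eqP/H.
Qed.

(** A larger [R] leaves fewer agreements to check. Only bits above [b] are tested, so [b] itself may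
    leave [R]; this form is what the exchange of a point of [R] with an outside point requires. *)
Lemma separates_mono S R R' b :
  R :\ b \subset R' -> separates S R b -> separates S R' b.
Proof.
move=> /subsetP RR' /separatesP[x [y [xS yS xy H]]].
apply/separatesP; exists x, y; split=> // c bc cR; apply: H => //.
apply: contra cR => cR; apply: RR'; rewrite !inE cR andbT.
by apply: contraTneq bc => ->; rewrite ltnn.
Qed.

(* The bits outside R act as a trie on S: inserting a point x in S creates at
   most one branching level, because two distinct levels at which x branches
   off force the higher one to separate two old points. *)
Lemma card_separates S R : (#|[set b | (b \notin R) && separates S R b]| <= #|S|)%N.
Proof.
have [n] := ubnP #|S|; elim: n S => // n IHn S.
have [->|[x xS]] := set_0Vmem S.
  rewrite cards0 leqn0 cards_eq0 => _; apply/eqP/setP => b; rewrite !inE.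
  by apply/negP => /andP[_ /separatesP[x [y []]]]; rewrite inE.
rewrite (cardsD1 x S) xS ltnS => /IHn {IHn}.
set T := [set b | _]; set T' := [set b | _] => leT.
have branch c : c \in T' :\: T -> exists2 y, y \in S :\ x &
    x (lshift m c) != y (lshift m c) /\
    (forall e : 'I_(hdim m), (c < e)%N -> e \notin R ->
       x (lshift m e) = y (lshift m e)).
  rewrite !inE => /and3P[+ cR /separatesP[u [v [uS vS uv H]]]]; rewrite cR => /negP nT.
  have [uE|ux] := eqVneq u x.
    exists v; last by rewrite -uE.
    by rewrite !inE vS andbT; apply: contraNneq uv => ->; rewrite uE.
  have [vE|vx] := eqVneq v x.
    exists u; first by rewrite !inE ux.
    by rewrite -vE eq_sym; split=> // e ce eR; rewrite H.
  by case: nT; apply/separatesP; exists u, v; rewrite !inE ux vx.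
have key (b b' : 'I_(hdim m)) : b \in T' :\: T -> b' \in T' :\: T -> (b' <= b)%N.
  move=> /branch[y yS [_ xy]] b'T; rewrite leqNgt; apply/negP => bb'.
  have [y' y'S [xy'b xy']] := branch _ b'T.
  move: b'T; rewrite !inE => /andP[/negP nT /andP[b'R _]]; apply: nT.
  rewrite b'R; apply/separatesP; exists y, y'; split=> //.
    by rewrite -(xy b').
  by move=> e b'e eR; rewrite -xy ?(ltn_trans bb')// xy'.
rewrite -(cardsID T T') addnC leq_add//; last first.
  by rewrite (leq_trans _ leT)// subset_leq_card// subsetIr.
apply/card_le1_eqP => b b' bT b'T; apply/val_inj/eqP.
by rewrite eqn_leq !key.
Qed.

Lemma top_difference (P : pred 'I_(hdim m + m)) x y b0 : P b0 -> x b0 != y b0 ->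
  exists t : 'I_(hdim m + m), [/\ P t, x t != y t, (b0 <= t)%N &
    forall b : 'I_(hdim m + m), (t < b)%N -> P b -> x b = y b].
Proof.
move=> Pb0 xyb0.
have Qb0 : [pred b | P b && (x b != y b)] b0 by rewrite /= Pb0.
case: (arg_maxnP (@nat_of_ord _) Qb0) => t /= /andP[Pt xyt] tmax.
exists t; split=> [|||b tb Pb] //.
  by apply: tmax; rewrite Pb0.
apply/eqP/negPn/negP => nb; have := tmax b; rewrite Pb nb => /(_ isT).
by rewrite leqNgt => /negP; apply.
Qed.

Lemma val_cube_lt x y (t : 'I_(hdim m + m)) :
  x t = false -> y t = true ->
  (forall b : 'I_(hdim m + m), (t < b)%N -> x b = y b) -> (val_cube x < val_cube y)%N.
Proof.
have valE (z : cube m) : (val_cube z)%:Z = \sum_b (z b)%:Z * 2%:Z ^+ b.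
  rewrite /val_cube /bits_val -[LHS]natz natr_sum; apply: eq_bigr => b _.
  by rewrite natrM natrX !natz.
move=> xt yt xy; rewrite -ltz_nat !valE -subr_gt0 -sumrB.
under eq_bigr do rewrite -mulrBl.
apply: (@base_expansion_gt0 _ 2 _ t) => // [b|b tb|].
- by case: (x b); case: (y b).
- by rewrite (xy b)// subrr.
- by rewrite xt yt.
Qed.

(** * Dependence of the signed graph on the random signs *)

Section Sign.
Variables (R : {set 'I_(hdim m)}) (r : {ffun 'I_(hdim m) -> 'I_(hdim m)}).

(** Both models in one form, up to conversion: [f_fun] is the case [s i = alpha (r i)] and [g_fun]
    the case [s = beta]. *)
Definition signed_fun (s : 'I_(hdim m) -> bool) (x : cube m) : int :=
  base_sum R x +
  (-1) ^+ s (cell x) * (x (lshift m (r (cell x))))%:R * 3%:Z ^+ (r (cell x)).+1.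

Hypothesis rR : forall i, r i \in R.

(** Above [t] the expansions of both values have the same digits: bits outside [R] agree there, and
    positions of [R] carry the digit 0 because both signed terms sit below [t]. So the digit at [t]
    decides. *)
Lemma signed_fun_lt s x y (t : 'I_(hdim m + m)) :
  t \notin [set lshift m a | a in R] -> x t = false -> y t = true ->
  (forall b : 'I_(hdim m + m), (t < b)%N ->
     b \notin [set lshift m a | a in R] -> x b = y b) ->
  (r (cell x) < t)%N -> (r (cell y) < t)%N ->
  signed_fun s x < signed_fun s y.
Proof.
pose LR := [set lshift m a | a in R].
pose low (b : 'I_(hdim m + m)) z := b == lshift m (r (cell z)).
(* The base 3 digit of [signed_fun s z] at [b]; inside [R] it vanishes except at the bit chosen for
   the cell of [z]. The weights are [3 ^ b.+1], whence the factor 3 in [coE]. *)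
pose co z (b : 'I_(hdim m + m)) : int := if b \in LR then
   (low b z)%:R * ((-1) ^+ s (cell z) * (z b)%:R) else (z b)%:R.
have inLR i : lshift m (r i) \in LR by exact: imset_f.
have coE z : signed_fun s z = 3%:Z * \sum_b co z b * 3%:Z ^+ b.
  rewrite /signed_fun /base_sum mulr_sumr [RHS](bigID (mem LR)) /= addrC.
  congr (_ + _).
    by apply: eq_bigr => b /negbTE bR; rewrite /co bR exprS mulrCA.
  rewrite (bigD1 (lshift m (r (cell z)))) ?inLR//= big1 ?addr0.
    by rewrite /co inLR /low eqxx mul1r exprS mulrCA.
  by move=> b /andP[bR /negbTE nb]; rewrite /co bR /low nb !mul0r mulr0.
have co1 z b : `|co z b| <= 1.
  rewrite /co; case: ifP => _; last by case: (z b).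
  rewrite !normrM normrX normrN1 expr1n mul1r.
  by case: (low b z); case: (z b).
move=> tR xt yt xy xlt ylt; rewrite !coE ltr_pM2l// -subr_gt0 -sumrB.
under eq_bigr do rewrite -mulrBl.
apply: (@base_expansion_gt0 _ 3 _ t) => // [b|b tb|].
- by apply: le_trans (ler_normB _ _) _; apply: (lerD (co1 y b) (co1 x b)).
- rewrite /co; case: ifPn => bR; last by rewrite (xy b)// subrr.
  have lowF z : (r (cell z) < t)%N -> low b z = false.
    by move=> zt; apply: contraTF tb => /eqP->; rewrite -leqNgt /= ltnW.
  by rewrite !lowF// !mul0r subrr.
- by rewrite /co (negbTE tR) xt yt.
Qed.

(** The highest differing bit is a top bit, hence lies outside [R] and above every [r i]; it decides
    the order of the values exactly as it decides [prec]. *)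
Lemma signed_fun_lt_cell s x y : cell x != cell y -> prec x y ->
  signed_fun s x < signed_fun s y.
Proof.
move=> cxy xy.
have [j xyj] : exists j, x (rshift (hdim m) j) != y (rshift (hdim m) j).
  apply/existsP; apply: contraNT cxy => /existsPn H; apply/eqP/val_inj => /=.
  by apply: eq_bigr => j _; rewrite /top_bits (eqP (negPn (H j))).
have [t [_ xyt jt Ht]] := @top_difference predT _ _ _ isT xyj.
have dt : (hdim m <= t)%N by rewrite (leq_trans _ jt)//= leq_addr.
have {}xyt : x t = false /\ y t = true.
  move: xyt; case xt: (x t); case yt: (y t) => // _.
  move: xy; rewrite /prec ltnNge ltnW// (@val_cube_lt y x t)// => b tb.
  by rewrite Ht.
case: xyt => xt yt; apply: (signed_fun_lt _ _ xt yt).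
- apply/negP => /imsetP[a _ ta]; move: dt; rewrite ta /= leqNgt.
  by rewrite ltn_ord.
- by move=> b tb _; apply: Ht.
- exact: leq_trans dt.
- exact: leq_trans dt.
Qed.

Lemma graph_signed_fun Q s s' :
  (forall i, separates (Q :&: C_ i) R (r i) -> s i = s' i) ->
  graph_of Q (signed_fun s) = graph_of Q (signed_fun s').
Proof.
move=> ss'; apply/ffunP => -[x y]; rewrite !ffunE /=.
case: ifP => // /and3P[xQ yQ xy]; congr Some.
have [cxy|cxy] := eqVneq (cell x) (cell y); last first.
  by rewrite /sgn !signed_fun_lt_cell.
have [sE|sN] := eqVneq (s (cell x)) (s' (cell x)).
  by rewrite /sgn /signed_fun -!cxy sE.
have nsep : ~~ separates (Q :&: C_ (cell x)) R (r (cell x)).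
  by apply: contra sN => /ss' ->.
(* If the two points agree at the signed bit, their signed terms are equal and only [base_sum] is
   compared, whatever the sign. *)
have [xyr|xyr] := eqVneq (x (lshift m (r (cell x)))) (y (lshift m (r (cell x)))).
  by rewrite /sgn /signed_fun -!cxy -!xyr !ltrD2r !(inj_eq (addIr _)).
(* The points differ at the signed bit without being separated by it, so a higher low bit outside
   [R] differs too; the highest difference outside [R] then fixes the order for every choice of
   signs. *)
have [c [rc cR xyc]] : exists c : 'I_(hdim m), [/\ (r (cell x) < c)%N, c \notin R &
    x (lshift m c) != y (lshift m c)].
  have /existsP[c /and3P[]] : [exists c : 'I_(hdim m),
      [&& (r (cell x) < c)%N, c \notin R & x (lshift m c) != y (lshift m c)]].
    apply: contraNT nsep => /existsPn H; apply/separatesP; exists x, y.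
    rewrite !in_setI xQ yQ !mem_C -cxy eqxx; split=> // c rc cR.
    by have := H c; rewrite rc cR negbK => /eqP.
  by exists c.
have cLR : lshift m c \notin [set lshift m a | a in R].
  by apply/negP => /imsetP[a aR /lshift_inj ca]; rewrite ca aR in cR.
have [t [tR xyt ct Ht]] :=
  @top_difference [pred b | b \notin [set lshift m a | a in R]] _ _ _ cLR xyc.
have rt : (r (cell x) < t)%N by apply: leq_trans rc ct.
move: xyt; case xt: (x t); case yt: (y t) => // _.
- have lt s0 : signed_fun s0 y < signed_fun s0 x.
    apply: (signed_fun_lt _ _ yt xt) => //; last by rewrite -cxy.
    by move=> b tb bR; rewrite Ht.
  by rewrite /sgn !ltNge !ltW //= !gt_eqF.
- have lt s0 : signed_fun s0 x < signed_fun s0 y.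
    by apply: (signed_fun_lt _ _ xt yt) => //; rewrite -cxy.
  by rewrite /sgn !lt.
Qed.

End Sign.

End Geometry.


(** * Permuting signs, and comparison of the two laws outside collisions *)

Lemma perm_extend (T : finType) (S : {set T}) (f : T -> T) :
  {in S &, injective f} -> exists s : {perm T}, {in S, s =1 f}.
Proof.
have [n] := ubnP #|S|; elim: n S => // n IHn S.
have [->|[x xS]] := set_0Vmem S; first by exists 1%g => x; rewrite inE.
rewrite (cardsD1 x S) xS ltnS => /IHn {}IHn injf.
have [|s sf] := IHn.
  by apply: sub_in2 injf => y; rewrite inE => /andP[].
(* Correcting [s] by this transposition repairs the value at [x] and moves no other [f y], since
   [f y] differs from both [s x] and [f x]. *)
exists (s * tperm (s x) (f x))%g => y yS; rewrite permM.
have [->|yx] := eqVneq y x; first by rewrite tpermL.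
have sy : s y = f y by apply: sf; rewrite !inE yx.
rewrite tpermD// sy; last by apply: contra_neq yx => /injf->.
by rewrite -sy (inj_eq perm_inj) eq_sym.
Qed.

Section Probability.
Variable K : realType.

Lemma unif_ge0 (T : finType) (A : {set T}) a : 0 <= unif K A a.
Proof. by rewrite /unif divr_ge0. Qed.

Lemma sum_unif (T : finType) (A : {set T}) : A != set0 -> \sum_a unif K A a = 1.
Proof.
move=> A0; rewrite -mulr_suml -natr_sum (_ : \sum_a _ = #|A|)%N.
  by rewrite divff// pnatr_eq0 cards_eq0.
by rewrite -sum1_card [RHS]big_mkcond; apply: eq_bigr => a _; case: (a \in A).
Qed.

Lemma sum_prod_unif (I T : finType) (A : {set T}) : A != set0 ->
  \sum_(r : {ffun I -> T}) \prod_i unif K A (r i) = 1.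
Proof.
by move=> A0; rewrite -(bigA_distr_bigA (fun _ => unif K A)) big1// => i _;
  exact: sum_unif.
Qed.

Lemma sum_prod_unif_pair (I T : finType) (A : {set T}) (i j : I) (b : T) :
  A != set0 -> b \in A -> i != j ->
  \sum_(r : {ffun I -> T}) (\prod_l unif K A (r l)) * ((r i == b) && (r j == b))%:R
    = (#|A|%:R^-1) ^+ 2.
Proof.
move=> A0 bA ij.
(* The event is absorbed into the factors of [i] and [j], so that the sum over [r] becomes a product
   of sums. *)
pose F l c : K := unif K A c * (if (l == i) || (l == j) then (c == b)%:R else 1).
have -> : \sum_(r : {ffun I -> T}) (\prod_l unif K A (r l)) *
    ((r i == b) && (r j == b))%:R = \sum_(r : {ffun I -> T}) \prod_l F l (r l).
  apply: eq_bigr => r _; rewrite /F [RHS]big_split /=; congr (_ * _).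
  rewrite (bigD1 i)//= eqxx (bigD1 j) 1?eq_sym//= eqxx orbT big1 ?mulr1 -?natrM ?mulnb//.
  by move=> l /andP[/negbTE-> /negbTE->].
rewrite -(bigA_distr_bigA F).
have one l : (l == i) || (l == j) -> \sum_c F l c = #|A|%:R^-1.
  move=> lE; rewrite (bigD1 b)//= big1 ?addr0; last first.
    by move=> c /negbTE cb; rewrite /F lE cb mulr0.
  by rewrite /F lE eqxx mulr1 /unif bA mul1r.
rewrite (bigD1 i)//= (bigD1 j) 1?eq_sym//= !one ?eqxx ?orbT// big1 ?mulr1// => l.
move=> /andP[/negbTE li /negbTE lj]; rewrite -[RHS](sum_unif A0).
by apply: eq_bigr => c _; rewrite /F li lj mulr1.
Qed.

(** Triangle inequality: it lets the two laws be compared conditionally on [k], then [R], then [r],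
    which they sample in the same way. *)
Lemma mixture_l1 (I T : finType) (w : I -> K) (p q : I -> T -> K) :
  (forall i, 0 <= w i) ->
  \sum_t `|\sum_i w i * p i t - \sum_i w i * q i t| <=
  \sum_i w i * \sum_t `|p i t - q i t|.
Proof.
move=> w0; under [leRHS]eq_bigr do rewrite mulr_sumr.
rewrite exchange_big /=; apply: ler_sum => t _; rewrite -sumrB.
apply: le_trans (ler_norm_sum _ _ _) _; apply: ler_sum => i _.
by rewrite -mulrBr normrM ger0_norm.
Qed.

Section Coupling.
Variables (m : nat) (Q : {set cube m}).
Implicit Types (R : {set 'I_(hdim m)}) (r : {ffun 'I_(hdim m) -> 'I_(hdim m)}).
Implicit Types (alpha beta : {ffun 'I_(hdim m) -> bool}).

Definition collision R r : bool :=
  [exists i, exists j, [&& i != j, r i == r j, separates (Q :&: C_ i) R (r i) &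
                                           separates (Q :&: C_ j) R (r j)]].

(** [alpha] and [beta] are indexed by the same type, so one probability serves both; [alpha] and
    [beta] are integrated out before [k], [R] and [r]. *)
Definition signs_prob (P : pred {ffun 'I_(hdim m) -> bool}) : K :=
  \sum_(s : {ffun 'I_(hdim m) -> bool}) (\prod_i unif K [set: bool] (s i)) * (P s)%:R.

Lemma signs_prob_ge0 P : 0 <= signs_prob P.
Proof.
by apply: sumr_ge0 => s _; rewrite mulr_ge0// prodr_ge0// => i _; exact: unif_ge0.
Qed.

Lemma setT_bool_neq0 : [set: bool] != set0.
Proof. by apply/set0Pn; exists true; rewrite inE. Qed.

Lemma signs_prob_perm (s : {perm 'I_(hdim m)}) P :
  signs_prob (fun a => P [ffun i => a (s i)]) = signs_prob P.
Proof.
pose h (a : {ffun 'I_(hdim m) -> bool}) := [ffun i => a (s i)].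
pose h' (a : {ffun 'I_(hdim m) -> bool}) := [ffun i => a (s^-1 i)%g].
have hK : cancel h h' by move=> a; apply/ffunP => i; rewrite !ffunE permKV.
have h'K : cancel h' h by move=> a; apply/ffunP => i; rewrite !ffunE permK.
rewrite /signs_prob [RHS](reindex h) /=; last by exists h'; [exact: in1W|exact: in1W].
apply: eq_bigr => a _; congr (_ * _); apply: eq_bigr => i _.
by rewrite /unif !inE.
Qed.

Lemma sum_signs_prob (T : finType) (F : {ffun 'I_(hdim m) -> bool} -> T) :
  \sum_t signs_prob (fun s => F s == t) = 1.
Proof.
rewrite exchange_big /= -[RHS](sum_prod_unif 'I_(hdim m) setT_bool_neq0).
apply: eq_bigr => s _; rewrite -mulr_sumr (bigD1 (F s))//= eqxx.
rewrite [X in _ + X]big1 ?addr0 ?mulr1//.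
by move=> t /negbTE tF; rewrite eq_sym tF.
Qed.

(* Without collision r is injective on the cells whose graph depends on the
   sign, so it agrees there with a permutation, which preserves the law of alpha. *)
Lemma no_collision_law R r (G : sgraph m) : (forall i, r i \in R) -> ~~ collision R r ->
  signs_prob (fun alpha => graph_of Q (f_fun R r alpha) == G) =
  signs_prob (fun beta => graph_of Q (g_fun R r beta) == G).
Proof.
move=> rR ncol; pose S := [set i | separates (Q :&: C_ i) R (r i)].
have injr : {in S &, injective r}.
  move=> i j; rewrite !inE => iS jS rij; apply/eqP/negPn/negP => ij.
  move/negP: ncol; apply; apply/existsP; exists i; apply/existsP; exists j.
  by rewrite ij rij eqxx jS -rij iS.
have [s sr] := perm_extend injr; rewrite -[RHS](signs_prob_perm s).
apply: eq_bigr => a _; congr (_ * (_ == _)%:R).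
apply: (graph_signed_fun rR (s := fun i => a (r i))) => i iS.
by rewrite ffunE sr ?inE.
Qed.

(** With a collision, the bound is the total mass of two probability laws; the factor 2 cancels the
    one half in [dTV]. *)
Lemma collision_l1 R r : (forall i, r i \in R) ->
  \sum_(G : sgraph m)
     `|signs_prob (fun alpha => graph_of Q (f_fun R r alpha) == G) -
       signs_prob (fun beta => graph_of Q (g_fun R r beta) == G)| <=
  2 * (collision R r)%:R.
Proof.
move=> rR; case: (boolP (collision R r)) => col; last first.
  by rewrite big1 ?mulr0// => G _; rewrite no_collision_law// subrr normr0.
have -> : 2 * true%:R = 1 + 1 :> K by rewrite mulr1.
rewrite -[X in X + _](sum_signs_prob (fun alpha => graph_of Q (f_fun R r alpha))).
rewrite -[X in _ + X](sum_signs_prob (fun beta => graph_of Q (g_fun R r beta))).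
rewrite -big_split /=; apply: ler_sum => G _.
by rewrite (le_trans (ler_normB _ _))// !ger0_norm ?signs_prob_ge0.
Qed.

Definition mean_kRr
    (F : {set 'I_(hdim m)} -> {ffun 'I_(hdim m) -> 'I_(hdim m)} -> K) : K :=
  \sum_(k : 'I_(m./2).+1) unif K [set k : 'I_(m./2).+1 | (1 <= k)%N] k *
  \sum_(R : {set 'I_(hdim m)})
     unif K [set R : {set 'I_(hdim m)} | #|R| == (2 ^ k)%N] R *
  \sum_(r : {ffun 'I_(hdim m) -> 'I_(hdim m)}) (\prod_i unif K R (r i)) * F R r.

Lemma law_YE G :
  law_Y K Q G = mean_kRr (fun R r => signs_prob (fun a => graph_of Q (f_fun R r a) == G)).
Proof.
rewrite /law_Y /expect; do 3 (apply: eq_bigr => ? _; congr (_ * _)).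
apply: eq_bigr => a _; congr (_ * _); rewrite -mulr_suml.
by rewrite (sum_prod_unif _ setT_bool_neq0) mul1r.
Qed.

Lemma law_NE G :
  law_N K Q G = mean_kRr (fun R r => signs_prob (fun b => graph_of Q (g_fun R r b) == G)).
Proof.
rewrite /law_N /expect; do 3 (apply: eq_bigr => ? _; congr (_ * _)).
by rewrite -mulr_suml (sum_prod_unif _ setT_bool_neq0) mul1r.
Qed.

Lemma dTV_collision :
  dTV (law_Y K Q) (law_N K Q) <= mean_kRr (fun R r => (collision R r)%:R).
Proof.
rewrite /dTV ler_pdivrMl//.
under eq_bigr do rewrite law_YE law_NE.
apply: le_trans (mixture_l1 _ _ _) _; first by move=> k; exact: unif_ge0.
rewrite mulr_sumr; apply: ler_sum => k _; rewrite mulrCA ler_wpM2l ?unif_ge0//.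
apply: le_trans (mixture_l1 _ _ _) _; first by move=> R; exact: unif_ge0.
rewrite mulr_sumr; apply: ler_sum => R _; rewrite mulrCA ler_wpM2l ?unif_ge0//.
have w0 r : 0 <= \prod_i unif K R (r i) by apply: prodr_ge0 => i _; exact: unif_ge0.
apply: le_trans (mixture_l1 _ _ _) _ => //.
rewrite mulr_sumr; apply: ler_sum => r _; rewrite mulrCA.
(* An [r] that takes a value outside [R] has weight 0. *)
have [/forallP rR|/forallPn[i riR]] := boolP [forall i, r i \in R].
  by rewrite ler_wpM2l// collision_l1.
by rewrite (bigD1 i)//= {1 3}/unif (negbTE riR) !mul0r.
Qed.

Definition sep_count R b : nat := #|[set i | separates (Q :&: C_ i) R b]|.

(** Union bound over the common value [b]. For each [b] the probability is at most 1, and by a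
    second union bound, over pairs of distinct cells separated by [b], at most the number of pairs
    times [1 / #|R| ^ 2]. *)
Lemma collision_prob R : R != set0 ->
  \sum_(r : {ffun 'I_(hdim m) -> 'I_(hdim m)})
     (\prod_i unif K R (r i)) * (collision R r)%:R <=
  \sum_(b in R) Num.min 1 (((sep_count R b)%:R / #|R|%:R) ^+ 2).
Proof.
move=> R0; pose N b := [set i | separates (Q :&: C_ i) R b].
pose hit b (r : {ffun 'I_(hdim m) -> 'I_(hdim m)}) :=
  [exists i in N b, exists j in N b, (i != j) && ((r i == b) && (r j == b))].
have w0 r : 0 <= \prod_i unif K R (r i) by apply: prodr_ge0 => i _; exact: unif_ge0.
apply: (@le_trans _ _ (\sum_(r : {ffun 'I_(hdim m) -> 'I_(hdim m)})
   \sum_(b in R) (\prod_i unif K R (r i)) * (hit b r)%:R)).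
  apply: ler_sum => r _; rewrite -mulr_sumr.
  have [/forallP rR|/forallPn[i riR]] := boolP [forall i, r i \in R]; last first.
    by rewrite (bigD1 i)//= /unif (negbTE riR) !mul0r.
  rewrite ler_wpM2l//; case: (boolP (collision R r)) => [|_]; last exact: sumr_ge0.
  move=> /existsP[i /existsP[j /and4P[ij /eqP rij si sj]]].
  rewrite (bigD1 (r i))//= (_ : hit (r i) r) ?lerDl ?sumr_ge0//.
  apply/existsP; exists i; rewrite inE si; apply/existsP; exists j.
  by rewrite inE rij sj ij !eqxx.
rewrite exchange_big /=; apply: ler_sum => b bR; rewrite le_min; apply/andP; split.
  rewrite -[leRHS](sum_prod_unif 'I_(hdim m) R0); apply: ler_sum => r _.
  by rewrite ler_piMr//; case: (hit b r).
apply: (@le_trans _ _ (\sum_(i in N b) \sum_(j in N b | i != j)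
  \sum_(r : {ffun 'I_(hdim m) -> 'I_(hdim m)})
     (\prod_l unif K R (r l)) * ((r i == b) && (r j == b))%:R)).
  under [leRHS]eq_bigr do rewrite exchange_big /=.
  rewrite [leRHS]exchange_big /=; apply: ler_sum => r _.
  move: (\prod_l _) (w0 r) => w wr0.
  have F0 i j : 0 <= w * ((r i == b) && (r j == b))%:R by exact: mulr_ge0.
  case: (boolP (hit b r)) => [|_]; last first.
    by rewrite mulr0; apply: sumr_ge0 => i _; apply: sumr_ge0.
  move=> /existsP[i /andP[iN /existsP[j /and3P[jN ij rb]]]].
  rewrite (bigD1 i)//= (bigD1 j) ?jN//= rb -addrA lerDl addr_ge0//; first exact: sumr_ge0.
  by apply: sumr_ge0 => i' _; apply: sumr_ge0.
(* The diagonal pairs are added back to obtain a full square. *)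
apply: (@le_trans _ _ (\sum_(i in N b) \sum_(j in N b) (#|R|%:R^-1) ^+ 2)).
  apply: ler_sum => i _; rewrite [leRHS](bigID (fun j => i != j)) /=.
  rewrite -[leLHS]addr0 lerD ?sumr_ge0// => [|j _]; last by rewrite exprn_ge0 ?invr_ge0.
  by apply: ler_sum => j /andP[_ ij]; rewrite sum_prod_unif_pair.
rewrite !sumr_const /sep_count -/(N b) exprMn -[leLHS]mulr_natl.
by rewrite -[X in _ * X <= _]mulr_natl mulrA -expr2.
Qed.

End Coupling.

End Probability.


(** * Random sets as images under random permutations, and a dyadic sum *)

Lemma perm_imset_transitive (T : finType) (A B : {set T}) :
  #|A| = #|B| -> exists s : {perm T}, s @: A = B.
Proof.
move=> AB; pose f x := nth x (enum B) (index x (enum A)).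
have lt x : x \in A -> (index x (enum A) < size (enum B))%N.
  by move=> xA; rewrite -cardE -AB cardE index_mem mem_enum.
have injf : {in A &, injective f}.
  move=> x y xA yA; rewrite /f (set_nth_default y)//; last exact: lt.
  move/eqP; rewrite nth_uniq ?enum_uniq ?lt// => /eqP.
  by apply: (@index_inj _ x); rewrite mem_enum.
have [s sf] := perm_extend injf; exists s; apply/eqP.
rewrite eqEcard card_imset ?AB ?leqnn ?andbT//; last exact: perm_inj.
by apply/subsetP => _ /imsetP[x xA ->]; rewrite sf// -mem_enum mem_nth// lt.
Qed.

Lemma imset_permM (T : finType) (s t : {perm T}) (A : {set T}) :
  (s * t)%g @: A = t @: (s @: A).
Proof. by rewrite -imset_comp; apply: eq_imset => x; rewrite permM. Qed.

Lemma tperm_imset (T : finType) (A : {set T}) (i j : T) :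
  i \in A -> j \in A -> tperm i j @: A = A.
Proof.
move=> iA jA; apply/eqP; rewrite eqEcard card_imset ?leqnn ?andbT; last exact: perm_inj.
by apply/subsetP => _ /imsetP[x xA ->]; case: tpermP.
Qed.

(** Double counting of [F (s @: R)] over all [s] and all [R] of the given size: each fixed [s]
    permutes these sets, and for each fixed [R] transitivity replaces [R] by [A]. *)
Lemma unif_set_perm (K : realType) (T : finType) (A : {set T}) (F : {set T} -> K) :
  \sum_R unif K [set R : {set T} | #|R| == #|A|] R * F R =
  #|{perm T}|%:R^-1 * \sum_(s : {perm T}) F (s @: A).
Proof.
set N := [set R | _].
have unifE : \sum_R unif K N R * F R = #|N|%:R^-1 * \sum_(R in N) F R.
  rewrite mulr_sumr [RHS]big_mkcond; apply: eq_bigr => R _; rewrite /unif.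
  by case: (R \in N); rewrite ?mul0r// mul1r.
have pos : (#|{perm T}|%:R : K) != 0.
  by rewrite pnatr_eq0 -lt0n; apply/card_gt0P; exists 1%g.
have Npos : (#|N|%:R : K) != 0.
  by rewrite pnatr_eq0 -lt0n; apply/card_gt0P; exists A; rewrite inE.
rewrite unifE; apply: (mulfI Npos); apply: (mulfI pos).
rewrite mulVKf// mulrCA mulVKf//.
have fix_s (s : {perm T}) : \sum_(R in N) F (s @: R) = \sum_(R in N) F R.
  rewrite [RHS](reindex_inj (imset_inj (@perm_inj _ s))) /=.
  by apply: eq_bigl => R; rewrite !inE card_imset//; exact: perm_inj.
have fix_R R : R \in N -> \sum_(s : {perm T}) F (s @: R) = \sum_(s : {perm T}) F (s @: A).
  rewrite inE eq_sym => /eqP /perm_imset_transitive[t <-].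
  by rewrite [RHS](reindex_inj (mulgI t)); apply: eq_bigr => s _; rewrite imset_permM.
transitivity (\sum_(s : {perm T}) \sum_(R in N) F (s @: R)).
  by rewrite (eq_bigr _ (fun s _ => fix_s s)) sumr_const mulr_natl.
by rewrite exchange_big /= (eq_bigr _ fix_R) sumr_const mulr_natl.
Qed.

(** Composing [s] with the transposition of [j0] and [j], both in [A], preserves [s @: A] and
    carries [s j] to the place of [s j0]; so each [j] in [A] contributes equally. *)
Lemma sum_perm_imset (V : nmodType) (T : finType) (A : {set T}) (j0 : T)
    (F : T -> {set T} -> V) : j0 \in A ->
  \sum_(s : {perm T}) \sum_(b in s @: A) F b (s @: A) =
  (\sum_(s : {perm T}) F (s j0) (s @: A)) *+ #|A|.
Proof.
move=> j0A.
under eq_bigr => s _ do rewrite (big_imset _ (in2W (@perm_inj _ s))) /=.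
rewrite exchange_big /= -sumr_const; apply: eq_bigr => j jA.
rewrite [RHS](reindex_inj (mulgI (tperm j0 j))); apply: eq_bigr => s _.
by rewrite permM tpermL imset_permM tperm_imset.
Qed.

(* Swapping s j0 with s j for j outside A changes s @: A only at these points;
   this turns a count at a point of s @: A into one at a point outside. *)
Lemma sum_perm_exchange (T : finType) (A : {set T}) (j0 : T)
    (c : {set T} -> T -> nat) (q : nat) : j0 \in A ->
  (forall (R R' : {set T}) b, R :\ b \subset R' -> (c R b <= c R' b)%N) ->
  (forall R : {set T}, (\sum_(b | b \notin R) c R b <= q)%N) ->
  (#|~: A| * \sum_(s : {perm T}) c (s @: A) (s j0) <= #|{perm T}| * q)%N.
Proof.
move=> j0A mono cq; rewrite -!sum_nat_const.
have swap j : j \in ~: A -> (\sum_(s : {perm T}) c (s @: A) (s j0) <=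
    \sum_(s : {perm T}) c (s @: A) (s j))%N.
  rewrite inE => jA; rewrite [leqRHS](reindex_inj (mulgI (tperm j0 j))) /=.
  apply: leq_sum => s _; rewrite permM tpermR imset_permM; apply: mono.
  apply/subsetP => b; rewrite !inE => /andP[bs /imsetP[a aA bE]].
  apply/imsetP; exists a => //; apply/imsetP; exists a => //; rewrite tpermD//.
    by apply: contraNneq bs => ->; rewrite bE.
  by apply: contraNneq jA => ->.
apply: (@leq_trans (\sum_(j in ~: A) \sum_(s : {perm T}) c (s @: A) (s j))).
  exact: leq_sum.
rewrite exchange_big /= [leqRHS](eq_bigl predT)//.
apply: leq_sum => s _; apply: leq_trans (cq (s @: A)).
rewrite [leqRHS](reindex_inj (@perm_inj _ s)) /= leq_eqVlt; apply/orP; left; apply/eqP.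
by apply: eq_bigl => j; rewrite inE mem_imset //; exact: perm_inj.
Qed.

(** The terms are at most [2 ^ k] while [2 ^ k] is below [n], and at most [n ^ 2 / 2 ^ k]
    afterwards: two geometric sums, each of order [n]. *)
Lemma dyadic_sum_min (K : realType) (n N : nat) :
  \sum_(k < N) 2 ^+ k * Num.min 1 ((n%:R / 2 ^+ k) ^+ 2) <= 4 * n%:R :> K.
Proof.
case: n => [|n].
  by rewrite big1 ?mulr0// => k _; rewrite mul0r expr0n /= min_r ?mulr0.
set x : K := n.+1%:R; have x1 : 1 <= x by rewrite ler1n.
pose S k : K := \sum_(k < k) 2 ^+ k * Num.min 1 ((x / 2 ^+ k) ^+ 2).
(* The subtracted quantity is the geometric tail, the sum of [x ^ 2 / 2 ^ k] over all [k] from [N]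
   on; keeping it makes the induction close. *)
suff [SN xSN] : S N <= 2 ^+ N /\ (x <= 2 ^+ N -> S N <= 4 * x - 2 * (x ^+ 2 / 2 ^+ N)).
  have [/xSN h|h] := leP x (2 ^+ N).
    apply: le_trans h _; rewrite lerBlDr lerDl mulr_ge0 ?divr_ge0 ?exprn_ge0//.
  by apply: le_trans SN _; lra.
elim: N => [|k [IH1 IH2]].
  rewrite /S big_ord0 expr0; split=> // h; nra.
have Sk : S k.+1 = S k + 2 ^+ k * Num.min 1 ((x / 2 ^+ k) ^+ 2).
  by rewrite /S big_ord_recr.
have p0 : 0 < 2 ^+ k :> K by rewrite exprn_gt0.
have min1 : 2 ^+ k * Num.min 1 ((x / 2 ^+ k) ^+ 2) <= 2 ^+ k.
  by rewrite ler_piMr ?ge_min ?lexx// ltW.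
have min2 : 2 ^+ k * Num.min 1 ((x / 2 ^+ k) ^+ 2) <= x ^+ 2 / 2 ^+ k.
  have -> : x ^+ 2 / 2 ^+ k = 2 ^+ k * (x / 2 ^+ k) ^+ 2.
    by field; rewrite gt_eqF.
  by rewrite ler_pM2l// ge_min lexx orbT.
have S1 : S k.+1 <= 2 ^+ k.+1.
  by rewrite Sk (le_trans (lerD IH1 min1))// exprS mulr_natl mulr2n.
split=> // xk1; have [xk|xk] := leP x (2 ^+ k).
  have -> : x ^+ 2 / 2 ^+ k.+1 = x ^+ 2 / 2 ^+ k / 2.
    by rewrite [2 ^+ k.+1]exprS invfM mulrA mulrAC.
  rewrite Sk; move: (IH2 xk) min2; set a := x ^+ 2 / _; set b := _ * Num.min _ _; lra.
apply: le_trans S1 _; move: xk xk1; rewrite exprS; move: (2 ^+ k) p0 => p p0 xk xk1.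
have -> : x ^+ 2 / (2 * p) = x ^+ 2 / p / 2 by rewrite invfM mulrA mulrAC.
(* Here [p < x <= 2 p], and the convex quadratic [x ^ 2 - 4 p x + 2 p ^ 2] is negative at both ends
   of this interval. *)
suff : x ^+ 2 / p <= 4 * x - 2 * p by lra.
rewrite ler_pdivrMr//; nra.
Qed.

(** * Mean number of cells separated by a random bit, and the final bound *)

Section Main.
Variables (K : realType) (m : nat) (Q : {set cube m}).

Lemma sep_count_mono (R R' : {set 'I_(hdim m)}) b :
  R :\ b \subset R' -> (sep_count Q R b <= sep_count Q R' b)%N.
Proof.
move=> RR'; apply/subset_leq_card/subsetP => i; rewrite !inE.
exact: separates_mono.
Qed.

(** Counting pairs of a bit and a cell by cells first reduces this to [card_separates], since the
    cells partition [Q]. *)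
Lemma sum_sep_count (R : {set 'I_(hdim m)}) :
  (\sum_(b | b \notin R) sep_count Q R b <= #|Q|)%N.
Proof.
have -> : (\sum_(b | b \notin R) sep_count Q R b =
    \sum_i #|[set b | (b \notin R) && separates (Q :&: C_ i) R b]|)%N.
  under eq_bigr do rewrite /sep_count -sum1dep_card big_mkcond /=.
  rewrite exchange_big /=; apply: eq_bigr => i _.
  by rewrite -sum1dep_card -big_mkcondr.
have -> : #|Q| = (\sum_i #|Q :&: C_ i|)%N.
  rewrite -sum1_card (partition_big (@cell m) predT)//=; apply: eq_bigr => i _.
  by rewrite -sum1_card; apply: eq_bigl => x; rewrite in_setI mem_C.
by apply: leq_sum => i _; exact: card_separates.
Qed.

(** Reference sets whose random images are the sets [R]. They are nested in [k], so one permutation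
    serves all [k] and [sep_count_mono] compares each [k] with the largest one. *)
Definition initial (k : nat) : {set 'I_(hdim m)} :=
  [set j : 'I_(hdim m) | (j < 2 ^ k)%N].

Lemma card_initial k : (k <= m)%N -> #|initial k| = (2 ^ k)%N.
Proof.
move=> km; have le : (2 ^ k <= hdim m)%N by rewrite leq_exp2l.
have inj : injective (widen_ord le) by move=> i j /(congr1 val) /= /val_inj.
rewrite -[RHS]card_ord -(card_imset _ inj).
apply: eq_card => j; rewrite inE; apply/idP/imsetP => [jk|[i _ ->]//=].
by exists (Ordinal jk) => //; apply/val_inj.
Qed.

Lemma collision_mean : (2 <= m)%N ->
  mean_kRr (fun R r => (collision Q R r)%:R : K) <= 24 * #|Q|%:R / ((hdim m)%:R * m%:R).
Proof.
move=> m2; set h := m./2; have hm : (h < m)%N by rewrite /h; lia.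
have h0 : (0 < h)%N by rewrite /h; lia.
pose o : 'I_(hdim m) := Ordinal (expn_gt0 2 m : (0 < hdim m)%N).
have oI k : o \in initial k by rewrite inE /= expn_gt0.
pose cnt k (s : {perm 'I_(hdim m)}) := sep_count Q (s @: initial k) (s o).
pose M : K := #|{perm 'I_(hdim m)}|%:R.
have M0 : 0 < M by rewrite ltr0n; apply/card_gt0P; exists 1%g.
have hK : 0 < h%:R :> K by rewrite ltr0n.
have step1 (k : 'I_h.+1) :
  \sum_R unif K [set R : {set 'I_(hdim m)} | #|R| == (2 ^ k)%N] R *
  (\sum_(r : {ffun 'I_(hdim m) -> 'I_(hdim m)})
     (\prod_i unif K R (r i)) * (collision Q R r)%:R) <=
  M^-1 * \sum_(s : {perm 'I_(hdim m)})
     2 ^+ k * Num.min 1 (((cnt h s)%:R / 2 ^+ k) ^+ 2).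
  have km : (k <= m)%N by rewrite (leq_trans _ (ltnW hm))// -ltnS.
  pose phi R b : K := Num.min 1 (((sep_count Q R b)%:R / 2 ^+ k) ^+ 2).
  apply: (@le_trans _ _ (\sum_R
      unif K [set R : {set 'I_(hdim m)} | #|R| == (2 ^ k)%N] R * \sum_(b in R) phi R b)).
    apply: ler_sum => R _; have [/eqP Rk|Rk] := boolP (#|R| == (2 ^ k)%N); last first.
      by rewrite /unif inE (negbTE Rk) !mul0r.
    rewrite ler_wpM2l ?unif_ge0//; apply: le_trans (collision_prob K Q _) _.
      by rewrite -card_gt0 Rk expn_gt0.
    by rewrite Rk natrX.
  rewrite -(card_initial km) unif_set_perm ler_pM2l ?invr_gt0//.
  rewrite (sum_perm_imset (fun b R => phi R b) (oI k)) card_initial//.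
  rewrite -[leLHS]mulr_natl natrX.
  rewrite mulr_sumr; apply: ler_sum => s _; rewrite ler_pM2l ?exprn_gt0//.
  rewrite le_min !ge_min lexx /=; apply/orP; right.
  rewrite lerXn2r ?nnegrE ?divr_ge0 ?exprn_ge0// ler_pM2r ?invr_gt0 ?exprn_gt0//.
  rewrite ler_nat; apply: sep_count_mono; rewrite (subset_trans (subsetDl _ _))//.
  apply: imsetS; apply/subsetP => j; rewrite !inE => /leq_trans; apply.
  by rewrite leq_exp2l// -ltnS.
(* Removing 0 leaves [h] values. The bound also covers [k = 0], of weight 0, so the sum can be
   extended to a full dyadic sum. *)
have u_le (k : 'I_h.+1) : unif K [set k : 'I_h.+1 | (1 <= k)%N] k <= h%:R^-1.
  rewrite /unif (_ : [set k : 'I_h.+1 | (1 <= k)%N] = [set~ ord0]).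
    by rewrite cardsC1 card_ord ler_piMl ?invr_ge0// lern1 leq_b1.
  by apply/setP => j; rewrite !inE lt0n.
apply: (@le_trans _ _ (\sum_(k < h.+1) h%:R^-1 * (M^-1 * \sum_(s : {perm 'I_(hdim m)})
     2 ^+ k * Num.min 1 (((cnt h s)%:R / 2 ^+ k) ^+ 2)))).
  apply: ler_sum => k _; apply: ler_pM => //; first exact: unif_ge0.
  apply: sumr_ge0 => R _; rewrite mulr_ge0 ?unif_ge0//; apply: sumr_ge0 => r _.
  by rewrite mulr_ge0// prodr_ge0// => i _; exact: unif_ge0.
rewrite -!mulr_sumr exchange_big /=.
apply: (@le_trans _ _ (h%:R^-1 * (M^-1 * (4 * (\sum_s cnt h s)%N%:R)))).
  rewrite !ler_pM2l ?invr_gt0// natr_sum mulr_sumr.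
  by apply: ler_sum => s _; exact: dyadic_sum_min.
have := sum_perm_exchange (oI h) sep_count_mono sum_sep_count.
rewrite -/(cnt h _) -(ler_nat K) !natrM -/M; set S := (\sum_s _)%:R => SM.
(* As [h < m], the set [initial h] fills at most half of the low coordinates. *)
have dlow : (hdim m)%:R <= 2 * #|~: initial h|%:R :> K.
  rewrite -natrM ler_nat; have := cardsC (initial h).
  rewrite (card_initial (ltnW hm)) card_ord.
  have : (2 * 2 ^ h <= hdim m)%N by rewrite -expnS leq_exp2l.
  by move: (hdim m) (2 ^ h)%N #|_| => d e f; clear; lia.
(* Equality holds at [m = 3]. The constant 24 is the product of this 3, the 2 of [dlow] and the 4 of
   [dyadic_sum_min]. *)
have m3h : m%:R <= 3 * h%:R :> K by rewrite -natrM ler_nat /h; lia.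
have d0 : 0 < (hdim m)%:R :> K by rewrite ltr0n expn_gt0.
have mK : 0 < m%:R :> K by rewrite ltr0n; lia.
have S0 : 0 <= S by exact: ler0n.
have Sdm : S * ((hdim m)%:R * m%:R) <= 6 * h%:R * (M * #|Q|%:R).
  apply: (@le_trans _ _ (6 * h%:R * (#|~: initial h|%:R * S))).
    rewrite [leRHS](_ : _ = S * ((2 * #|~: initial h|%:R) * (3 * h%:R))); last by ring.
    by rewrite ler_wpM2l// ler_pM// ltW.
  by rewrite ler_wpM2l// mulr_ge0// ltW.
rewrite ler_pdivlMr ?mulr_gt0//.
have -> : h%:R^-1 * (M^-1 * (4 * S)) * ((hdim m)%:R * m%:R) =
    (4 / (h%:R * M)) * (S * ((hdim m)%:R * m%:R)).
  by field; rewrite !gt_eqF.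
have -> : 24 * #|Q|%:R = (4 / (h%:R * M)) * (6 * h%:R * (M * #|Q|%:R)).
  by field; rewrite !gt_eqF.
by rewrite ler_wpM2l// divr_ge0// mulr_ge0// ltW.
Qed.

End Main.

Theorem theorem3p5 (K : realType) :
  exists (C delta0 : K) (d0 : nat), 0 < delta0 /\
    forall (delta : K) (m : nat),
      0 < delta -> delta <= delta0 -> (d0 <= hdim m)%N ->
      forall Q : {set cube m},
        #|Q|%:R <= delta * (hdim m)%:R * m%:R ->
        dTV (law_Y K Q) (law_N K Q) <= C * delta.
Proof.
(* The threshold 4 on [d] gives [m >= 2], so that the range of [k] is nonempty; 24 is the constant
   of [collision_mean]. *)
exists 24, 1, 4; split=> // delta m delta0 _ dm Q Qle.
have m2 : (2 <= m)%N by move: dm; rewrite /hdim -[4]/(2 ^ 2)%N leq_exp2l.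
have d0 : 0 < (hdim m)%:R :> K by rewrite ltr0n expn_gt0.
have m0 : 0 < m%:R :> K by rewrite ltr0n; lia.
apply: le_trans (dTV_collision K Q) _; apply: le_trans (collision_mean K Q m2) _.
by rewrite ler_pdivrMr ?mulr_gt0// -mulrA ler_pM2l// mulrA.
Qed.
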